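(* Let $F$ and $G$ be probability distributions on $\mathbb{R}^d$ such that $G$ is absolutely continuous with respect to $F$ and $G\neq F$. Put $l=\sqrt{\mathrm{d}G/\mathrm{d}F}$. If $v_F$ is an $F$-Brownian bridge, then the process $v_G$ with differential $$v_G(\mathrm{d}x) = l(x)\, v_F(\mathrm{d}x) - \int_{y\in\mathbb{R}^d} l(y)\, v_F(\mathrm{d}y)\; \frac{1}{1-\int_{y\in\mathbb{R}^d} l(y)\,\mathrm{d}F(y)}\,\bigl[l^2(x)-l(x)\bigr]\,\mathrm{d}F(x)$$ is a $G$-Brownian bridge. If, moreover, $G$ and $F$ are equivalent (mutually absolutely continuous), i.e. if $l$ is positive $F$-a.e., then this transformation $v_F\mapsto v_G$ is one-to-one.
   Context: For a probability distribution $F$ on $\mathbb{R}^d$, write $\langle\phi,\tilde\phi\rangle_F=\int\phi\tilde\phi\,\mathrm{d}F$ and let $q_0$ be the function identically equal to $1$. An $F$-Brownian motion $w_F$ is a family of centered jointly Gaussian random variables $w_F(\phi)$, $\phi\in L_2(F)$, (a.s.) linear in $\phi$, with $E\,w_F(\phi)w_F(\tilde\phi)=\langle\phi,\tilde\phi\rangle_F$. An $F$-Brownian bridge is a family distributed as $v_F(\phi)=w_F(\phi)-\langle\phi,q_0\rangle_F w_F(q_0)$, $\phi\in L_2(F)$; equivalently it is linear, centered Gaussian with covariance $\langle\phi,\tilde\phi\rangle_F-\langle\phi,q_0\rangle_F\langle\tilde\phi,q_0\rangle_F$. One writes $\int\phi(y)\,v_F(\mathrm{d}y)=v_F(\phi)$.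 The differential formula for $v_G$ is understood in function-parametric form: for $\psi\in L_2(G)$ (so that $l\psi\in L_2(F)$), $$v_G(\psi)=v_F(l\psi)-v_F(l)\,\frac{1}{1-\int l\,\mathrm{d}F}\int (l^2-l)\,\psi\,\mathrm{d}F .$$ ''One-to-one'' means that $v_F$ can be recovered from $v_G$: the displayed formula defines an injective map on the set of linear maps $v$ from $L_2(F)$ to (a.s. classes of) random variables satisfying $v(q_0)=0$ (a property every $F$-Brownian bridge has). *)

(* Defs.v *)
From HB Require Import structures.
From mathcomp Require Import all_boot all_order all_algebra.
From mathcomp Require Import all_classical all_reals all_analysis.
From mathcomp Require Import measurable_realfun.

Set Implicit Arguments.
Unset Strict Implicit.
Unset Printing Implicit Defensive.
Import Order.TTheory GRing.Theory Num.Theory.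
Import numFieldNormedType.Exports.
Local Open Scope classical_set_scope.
Local Open Scope ring_scope.

(* L_2(F) is taken as a set of functions rather than of F-a.e. classes, and a
   process indexed by L_2(F) is a function on all of [T -> R] whose values
   outside [L2 F] are irrelevant. *)

Section gaussian.
Context (R : realType) (disp : measure_display) (Omega : measurableType disp)
  (P : probability Omega R).

(* [normal_prob m 0] is not the point mass at m, whence the case distinction. *)
Definition normal_law (m s : R) : set R -> \bar R :=
  if s == 0 then dirac m else normal_prob m s.

Definition gaussian (X : {RV P >-> R}) :=
  exists m s : R, 0 <= s /\
    forall A : set R, measurable A -> distribution P X A = normal_law m s A.

Definition jointly_gaussian (I : Type) (D : set I)
    (X : I -> {RV P >-> R}) :=
  forall (n : nat) (i : 'I_n -> I) (a : 'I_n -> R),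
    (forall k, D (i k)) -> gaussian (\sum_(k < n) a k *: X (i k)).

End gaussian.

(* Equality of the finite-dimensional distributions over the index set D. *)
Definition same_fdd (R : realType) (I : Type) (D : set I)
    (d1 : measure_display) (O1 : measurableType d1) (P1 : probability O1 R)
    (X1 : I -> {RV P1 >-> R})
    (d2 : measure_display) (O2 : measurableType d2) (P2 : probability O2 R)
    (X2 : I -> {RV P2 >-> R}) :=
  forall (n : nat) (i : 'I_n -> I), (forall k, D (i k)) ->
  forall A : set (n.-tuple R), measurable A ->
    P1 [set t | A [tuple X1 (i k) t | k < n]] =
    P2 [set t | A [tuple X2 (i k) t | k < n]].

Section processes.
Context (R : realType) (dT : measure_display) (T : measurableType dT).
Implicit Types (F G : probability T R) (phi psi : T -> R).

Definition L2 F : set (T -> R) := [set phi | phi \in Lfun F 2%:E].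

Definition inner F phi psi : R := \int[F]_x (phi x * psi x).

Definition q0 : T -> R := cst 1.

Section on_one_space.
Context (disp : measure_display) (Omega : measurableType disp)
  (P : probability Omega R).
Implicit Types v w : (T -> R) -> {RV P >-> R}.

Definition as_eq F v v' :=
  forall phi, L2 F phi -> v phi = v' phi %[ae P].

(* v induces a linear map from the F-a.e. classes of L_2(F) to the a.s.
   classes of random variables. *)
Definition as_linear F v :=
  (forall phi psi, L2 F phi -> L2 F psi ->
     phi = psi %[ae F] -> v phi = v psi %[ae P]) /\
  (forall (a : R) phi psi, L2 F phi -> L2 F psi ->
     v (fun x => a * phi x + psi x) = (a *: v phi + v psi) %[ae P]).

Definition brownian_motion F w :=
  [/\ as_linear F w,
      jointly_gaussian (L2 F) w,
      (forall phi, L2 F phi -> ('E_P[w phi] = 0)%E) &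
      (forall phi psi, L2 F phi -> L2 F psi ->
         ('E_P[(w phi \* w psi)%R] = (inner F phi psi)%:E)%E)].

Definition bridge_of F w : (T -> R) -> {RV P >-> R} :=
  fun phi => w phi - inner F phi q0 *: w q0.

End on_one_space.

(* The Brownian motion may live on another probability space. *)
Definition brownian_bridge F (disp : measure_display)
    (Omega : measurableType disp) (P : probability Omega R)
    (v : (T -> R) -> {RV P >-> R}) :=
  exists (d' : measure_display) (Omega' : measurableType d')
         (P' : probability Omega' R) (w : (T -> R) -> {RV P' >-> R}),
    brownian_motion F w /\ same_fdd (L2 F) v (bridge_of F w).

(* The Radon-Nikodym derivative is nonnegative only F-a.e.; [Num.sqrt] is 0 on
   negative values. *)
Definition sqrt_density F G : T -> R :=
  fun x => Num.sqrt (fine (Radon_Nikodym (charge_of_finite_measure G) F x)).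

Definition bridge_transform F G (disp : measure_display)
    (Omega : measurableType disp) (P : probability Omega R)
    (v : (T -> R) -> {RV P >-> R}) : (T -> R) -> {RV P >-> R} :=
  let l := sqrt_density F G in
  fun psi =>
    v (fun x => l x * psi x) -
    ((1 - \int[F]_x l x)^-1 * \int[F]_x ((l x ^+ 2 - l x) * psi x)) *: v l.

End processes.

Arguments q0 {R dT T}.

(* Main.v *)
Require Import Defs.
From HB Require Import structures.
From mathcomp Require Import all_boot all_order all_algebra.
From mathcomp Require Import all_classical all_reals all_analysis.
From mathcomp Require Import measurable_realfun.
From mathcomp Require Import ring lra.

Set Implicit Arguments.
Unset Strict Implicit.
Unset Printing Implicit Defensive.
Import Order.TTheory GRing.Theory Num.Theory.
Import numFieldNormedType.Exports.
Local Open Scope classical_set_scope.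
Local Open Scope ring_scope.

(** Let l be the square root of dG/dF and u = l - 1 in L_2(F).

    Multiplication by l is an isometry from L_2(G) into L_2(F), because
    l^2 dF = dG.  It sends the constant 1 to l.  Both l and 1 are unit vectors
    of L_2(F), and they differ because G and F do, so the Householder reflection
    H along u exchanges them.  Hence K psi = H (l psi) is an isometry from
    L_2(G) into L_2(F) with K 1 = 1.  Composing an F-Brownian motion w with an
    isometry gives a G-Brownian motion w o K ([brownian_motion_isometry]); no
    computation with Gaussian laws occurs.  Since K fixes the constants, the
    bridge built from w o K is psi |-> v(K psi), where v is the bridge built
    from w.

    It remains to see that this is the transformation of the statement.
    As <u, u> = 2 (1 - <l, 1>), the coefficient in front of v(l) there is
    2 <l psi, u> / <u, u>, the coefficient of u in the reflection of l psi
    ([bridge_transformE]).  A bridge kills constants, so for it v(u) = v(l), and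
    v(K psi) = v(l psi) - 2 <l psi, u> / <u, u> v(l)
    ([bridge_of_gap_isometry]).  A bridge is only known up to its
    finite-dimensional distributions, and these are transported by linear
    combinations of finitely many coordinates ([same_fdd_lin]).

    For injectivity, when l is a.e. nonzero every phi in L_2(F) is a.e. equal
    to l psi with psi = phi / l in L_2(G), so the transform determines
    v(phi) - c(phi) v(l), where c(phi) = 2 <phi, u> / <u, u>.  For phi = 1 the
    coefficient is -1 and v(1) = 0, which yields v(l), and then v(phi) for all
    phi. *)

(** * The inner product of L_2(F) *)

Section inner_product.
Context (R : realType) (dT : measure_display) (T : measurableType dT).
Implicit Types (F G : probability T R) (phi psi chi : T -> R).

Lemma L2P F phi : L2 F phi <->
  measurable_fun setT phi /\ F.-integrable setT (EFin \o (fun x => phi x ^+ 2)).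
Proof.
split=> [Lphi|[mphi /integrableP[_ iphi]]].
  split; last exact: Lfun2_integrable_sqr.
  by move: Lphi; rewrite /L2/= => /andP[/[!inE]].
rewrite /L2/= inE; apply/andP; split; rewrite inE//=.
rewrite /finite_norm unlock poweR_lty//; apply: le_lt_trans iphi.
under eq_integral do rewrite /= powR_mulrn//.
by under [leRHS]eq_integral do rewrite /= normrX.
Qed.

Lemma L2_measurable F phi : L2 F phi -> measurable_fun setT phi.
Proof. by case/L2P. Qed.

Lemma L2_mul_integrable F phi psi : L2 F phi -> L2 F psi ->
  F.-integrable setT (EFin \o (fun x => phi x * psi x)).
Proof. by move=> Lphi Lpsi; apply/Lfun1_integrable; exact: Lfun2_mul_Lfun1. Qed.

Lemma L2_lin F a phi psi : L2 F phi -> L2 F psi ->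
  L2 F (fun x => a * phi x + psi x).
Proof.
move=> Lphi Lpsi; have p1 : (1 <= 2%:E :> \bar R)%E by rewrite lee1n.
by have [_] := Lfun_submod_closed F p1; apply.
Qed.

Lemma L2_q0 F : L2 F q0.
Proof. exact: Lfun_cst. Qed.

Lemma inner_q0 F : inner F q0 q0 = 1.
Proof.
rewrite /inner /q0/= mulr1 Rintegral_cst// mul1r.
exact: (congr1 fine (@probability_setT _ _ _ F)).
Qed.

Lemma innerC F phi psi : inner F phi psi = inner F psi phi.
Proof. by apply: eq_Rintegral => x _; rewrite mulrC. Qed.

Lemma inner_linl F a phi psi chi : L2 F phi -> L2 F psi -> L2 F chi ->
  inner F (fun x => a * phi x + psi x) chi =
    a * inner F phi chi + inner F psi chi.
Proof.
move=> Lphi Lpsi Lchi; have iphi := L2_mul_integrable Lphi Lchi.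
rewrite /inner -RintegralZl// -RintegralD//; last 2 first.
- have := integrableZl measurableT a iphi.
  by apply: eq_integrable => // x _; rewrite /= EFinM.
- exact: L2_mul_integrable.
by apply: eq_Rintegral => x _; rewrite mulrDl mulrA.
Qed.

Lemma inner_linr F a phi psi chi : L2 F phi -> L2 F psi -> L2 F chi ->
  inner F chi (fun x => a * phi x + psi x) =
    a * inner F chi phi + inner F chi psi.
Proof. by move=> *; rewrite innerC inner_linl// !(innerC _ chi). Qed.

Lemma inner_ae_eql F phi psi chi : L2 F phi -> L2 F psi -> L2 F chi ->
  phi = psi %[ae F] -> inner F phi chi = inner F psi chi.
Proof.
move=> Lphi Lpsi Lchi e; congr fine; apply: ae_eq_integral => //.
- by have /integrableP[] := L2_mul_integrable Lphi Lchi.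
- by have /integrableP[] := L2_mul_integrable Lpsi Lchi.
- by apply: filterS e => x /= /[apply] ->.
Qed.

Lemma inner_eq0 F phi : L2 F phi -> inner F phi phi = 0 -> phi = cst 0 %[ae F].
Proof.
move=> Lphi; have iphi := L2_mul_integrable Lphi Lphi.
have fphi := integrable_fin_num measurableT iphi.
move=> h0; have {}h0 : (\int[F]_x (phi x * phi x)%:E = 0)%E.
  by rewrite -[LHS](fineK fphi); exact: (congr1 EFin h0).
have mphi2 := measurable_int F iphi.
have [+ _] := ae_eq_integral_abs F measurableT mphi2.
under eq_integral do rewrite /= normrM -expr2 real_normK ?num_real// expr2.
move=> /(_ h0); apply: filterS => x /= /(_ I)[].
by move/eqP; rewrite mulf_eq0 orbb => /eqP.
Qed.

End inner_product.

(** * The isometry given by the square root of the density *)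

Section sqrt_density.
Context (R : realType) (dT : measure_display) (T : measurableType dT).
Variables F G : probability T R.
Hypothesis GF : G `<< F.
Local Notation l := (sqrt_density F G).

Lemma measurable_sqrt_density : measurable_fun setT l.
Proof.
apply: measurableT_comp => //; first 
  by apply: continuous_measurable_fun; exact: sqrt_continuous.
exact: measurableT_comp.
Qed.

(** The chosen Radon-Nikodym derivative may be negative on a null set, but it
    agrees a.e. with a version that is nonnegative everywhere. *)
Lemma sqr_sqrt_density :
  \forall x \ae F,
    Radon_Nikodym (charge_of_finite_measure G) F x = (l x ^+ 2)%:E.
Proof.
have := ae_eq_Radon_Nikodym_SigmaFinite GF measurableT.
apply: filterS => x /(_ I) h; rewrite /sqrt_density -h sqr_sqrtr.
  by rewrite fineK// Radon_Nikodym_SigmaFinite.f_fin_num.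
by rewrite fine_ge0// Radon_Nikodym_SigmaFinite.f_ge0.
Qed.

(** For nonnegative functions no integrability is required, which is what allows
    integrability to be moved between F and G in both directions. *)
Lemma ge0_integral_sqrt_density (D : set T) (f : T -> R) :
  measurable D -> measurable_fun setT f -> (forall x, 0 <= f x) ->
  (\int[F]_(x in D) (l x ^+ 2 * f x)%:E = \int[G]_(x in D) (f x)%:E)%E.
Proof.
move=> mD mf f0.
have ml := measurable_sqrt_density.
have mEf : measurable_fun D (EFin \o f).
  exact/measurable_funTS/measurable_EFinP.
rewrite -(Radon_Nikodym_SigmaFinite.change_of_variables GF _ mD mEf); last first.
  by move=> x; rewrite lee_fin.
apply: ae_eq_integral => //.
- apply/measurable_EFinP/measurable_funTS; apply: measurable_funM => //.
  exact: measurable_funX.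
- apply: emeasurable_funM => //.
  apply: measurable_funTS.
  exact: measurable_int (Radon_Nikodym_SigmaFinite.f_integrable _).
have := ae_eq_Radon_Nikodym_SigmaFinite GF measurableT.
apply: filterS2 sqr_sqrt_density => x h /(_ I) -> _.
by rewrite h -EFinM mulrC.
Qed.

Lemma L2_sqrt_densityM (psi : T -> R) : measurable_fun setT psi ->
  L2 G psi <-> L2 F (fun x => l x * psi x).
Proof.
move=> mpsi; have ml := measurable_sqrt_density.
have mlpsi : measurable_fun setT (fun x => l x * psi x).
  exact: measurable_funM.
have mX (f : T -> R) : measurable_fun setT f ->
    measurable_fun setT (EFin \o (fun x => f x ^+ 2)).
  by move=> mf; apply/measurable_EFinP; exact: measurable_funX.
have e : (\int[F]_x `|((l x * psi x) ^+ 2)%:E| = \int[G]_x `|(psi x ^+ 2)%:E|)%E.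
  under [RHS]eq_integral do rewrite gee0_abs ?lee_fin ?sqr_ge0//.
  have mpsi2 : measurable_fun setT (fun x => psi x ^+ 2) by exact: measurable_funX.
  rewrite -(ge0_integral_sqrt_density measurableT mpsi2)// => [|x].
    by apply: eq_integral => x _; rewrite gee0_abs ?lee_fin ?sqr_ge0// exprMn.
  by rewrite sqr_ge0.
split=> /L2P[_ /integrableP[_ i]]; apply/L2P; split=> //; apply/integrableP; split.
- exact: mX.
- by rewrite e.
- exact: mX.
- by rewrite -e.
Qed.

Lemma inner_sqrt_densityM (phi psi : T -> R) : L2 G phi -> L2 G psi ->
  inner F (fun x => l x * phi x) (fun x => l x * psi x) = inner G phi psi.
Proof.
move=> Lphi Lpsi; have iG := L2_mul_integrable Lphi Lpsi.
have iF : F.-integrable setT (EFin \o (fun x => l x * phi x * (l x * psi x))).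
  by apply: L2_mul_integrable; apply/L2_sqrt_densityM => //; apply: L2_measurable;
    [exact: Lphi|exact: Lpsi].
congr fine; rewrite -(Radon_Nikodym_change_of_variables GF)//.
apply: ae_eq_integral => //.
- by case/integrableP: iF.
- by apply: emeasurable_funM => //; case/integrableP: iG.
apply: filterS sqr_sqrt_density => x /= -> _; rewrite -EFinM; congr EFin; ring.
Qed.

Lemma L2_sqrt_density : L2 F l.
Proof.
have [+ _] := L2_sqrt_densityM (L2_measurable (L2_q0 G)).
by move=> /(_ (L2_q0 G)); under eq_fun do rewrite /q0/= mulr1.
Qed.

Lemma inner_sqrt_density : inner F l l = 1.
Proof.
transitivity (inner G q0 q0).
  rewrite -inner_sqrt_densityM; [|exact: L2_q0..].
  by apply: eq_Rintegral => x _; rewrite /q0/= !mulr1.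
exact: inner_q0.
Qed.

Lemma sqrt_density_eq1 : l = cst 1 %[ae F] ->
  forall A, measurable A -> G A = F A.
Proof.
move=> l1 A mA.
transitivity (\int[G]_(x in A) (1:R)%:E)%E; first by rewrite integral_cst// mul1e.
transitivity (\int[F]_(x in A) (1:R)%:E)%E; last by rewrite integral_cst// mul1e.
rewrite -ge0_integral_sqrt_density//.
apply: ae_eq_integral => //.
  apply/measurable_EFinP/measurable_funTS; apply: measurable_funM => //.
  by apply: measurable_funX; exact: measurable_sqrt_density.
by apply: filterS l1 => x /(_ I) -> _; rewrite expr1n mulr1.
Qed.

(** The zero set of l is G-null, because its G-measure is the integral of l^2
    over it, hence F-null. *)
Lemma sqrt_density_neq0 : F `<< G -> \forall x \ae F, l x != 0.
Proof.
move=> FG; pose Z := [set x | l x = 0].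
have mZ : measurable Z.
  by rewrite -[Z]setTI; exact: (measurable_sqrt_density measurableT (measurable_set1 0)).
exists Z; split => //; last by move=> x /= /negP; rewrite negbK => /eqP.
move/null_content_dominatesP: FG; apply => //.
transitivity (\int[G]_(x in Z) (1:R)%:E)%E; first by rewrite integral_cst// mul1e.
rewrite -ge0_integral_sqrt_density//.
by apply: integral0_eq => x; rewrite /Z/= => ->; rewrite expr0n mul0r.
Qed.

End sqrt_density.

(** * Householder reflections *)

Section householder.
Context (R : realType) (dT : measure_display) (T : measurableType dT).
Variables (F : probability T R) (u : T -> R).
Hypotheses (Lu : L2 F u) (u0 : inner F u u != 0).

Definition reflection_coef (phi : T -> R) := 2 * inner F phi u / inner F u u.

Definition householder (phi : T -> R) : T -> R :=
  fun x => - reflection_coef phi * u x + phi x.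

Lemma L2_householder phi : L2 F phi -> L2 F (householder phi).
Proof. exact: L2_lin. Qed.

Lemma householder_lin a phi psi : L2 F phi -> L2 F psi ->
  householder (fun x => a * phi x + psi x) =
  (fun x => a * householder phi x + householder psi x).
Proof.
move=> Lphi Lpsi; apply/funext => x.
by rewrite /householder /reflection_coef inner_linl//; ring.
Qed.

(** Expanding, the cross terms -4 <phi,u><psi,u>/<u,u> cancel against <u,u>
    times the product of the two reflection coefficients. *)
Lemma inner_householder phi psi : L2 F phi -> L2 F psi ->
  inner F (householder phi) (householder psi) = inner F phi psi.
Proof.
move=> Lphi Lpsi; have Lh := L2_householder Lpsi.
rewrite inner_linl// !inner_linr// (innerC F u psi) /reflection_coef.
by field.
Qed.

End householder.

(** * Brownian motions and isometries *)

Section isometry.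
Context (R : realType) (dS dT : measure_display)
  (S : measurableType dS) (T : measurableType dT).
Variables (F : probability T R) (G : probability S R).
Variable K : (S -> R) -> (T -> R).
Hypothesis L2K : forall psi, L2 G psi -> L2 F (K psi).
Hypothesis linK : forall a phi psi, L2 G phi -> L2 G psi ->
  K (fun x => a * phi x + psi x) = (fun x => a * K phi x + K psi x).
Hypothesis innerK : forall phi psi, L2 G phi -> L2 G psi ->
  inner F (K phi) (K psi) = inner G phi psi.

(** An isometry is compatible with a.e. equality because a null difference has
    an image of norm 0. *)
Lemma isometry_ae_eq phi psi : L2 G phi -> L2 G psi ->
  phi = psi %[ae G] -> K phi = K psi %[ae F].
Proof.
move=> Lphi Lpsi e; pose delta x := -1 * psi x + phi x.
have Ldelta : L2 G delta by exact: L2_lin.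
have delta0 : delta = cst 0 %[ae G].
  by apply: filterS e => x /= /[apply] e; rewrite /delta e; ring.
have : K delta = cst 0 %[ae F].
  apply: inner_eq0; first exact: L2K.
  rewrite innerK//; rewrite (inner_ae_eql (psi := cst 0) _ _ _ delta0)//.
    by rewrite /inner; under eq_Rintegral do rewrite mul0r;
      rewrite Rintegral_cst// mul0r.
  exact: Lfun_cst.
rewrite linK//; apply: filterS => x /= /[apply] h; apply/eqP.
by rewrite -subr_eq0 -h mulN1r addrC.
Qed.

(** Linearity, joint Gaussianity and the moments of w are statements about all
    of L_2(F), so restricting w to the range of an isometry preserves them. *)
Lemma brownian_motion_isometry (dO : measure_display) (Omega : measurableType dO)
    (P : probability Omega R) (w : (T -> R) -> {RV P >-> R}) :
  brownian_motion F w -> brownian_motion G (fun psi => w (K psi)).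
Proof.
move=> [[wae wlin] wgauss w0 wcov]; split.
- split=> [phi psi Lphi Lpsi e|a phi psi Lphi Lpsi].
    by apply: wae; [exact: L2K..|exact: isometry_ae_eq].
  by rewrite linK//; apply: wlin; exact: L2K.
- by move=> n i a Li; apply: (wgauss n (fun k => K (i k))) => k; exact: L2K.
- by move=> phi /L2K; exact: w0.
- by move=> phi psi Lphi Lpsi; rewrite wcov ?innerK//; exact: L2K.
Qed.

End isometry.

(** * The reflection exchanging 1 and the square root of the density *)

Section reflection.
Context (R : realType) (dT : measure_display) (T : measurableType dT).
Variables F G : probability T R.
Hypotheses (GF : G `<< F)
  (GneqF : ~ (forall A : set T, measurable A -> G A = F A)).
Local Notation l := (sqrt_density F G).
Local Notation Ml := (fun psi : T -> R => fun x => l x * psi x).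

(** The function l - 1, written in the shape to which linearity of a process
    applies syntactically. *)
Definition sqrt_density_gap : T -> R := fun x => -1 * q0 x + l x.
Local Notation u := sqrt_density_gap.

Lemma L2_gap : L2 F u.
Proof. by apply: L2_lin; [exact: L2_q0|exact: L2_sqrt_density]. Qed.

Lemma inner_gap phi : L2 F phi -> inner F phi u = inner F phi l - inner F phi q0.
Proof.
move=> Lphi; rewrite inner_linr//; first by ring.
- exact: L2_q0.
- exact: L2_sqrt_density.
Qed.

Lemma norm_gap : inner F u u = 2 * (1 - inner F l q0).
Proof.
have L1 := L2_q0 F; have Ll := L2_sqrt_density GF; have Lu := L2_gap.
rewrite inner_gap// (innerC F u l) (innerC F u q0) !inner_gap// inner_q0.
rewrite inner_sqrt_density// (innerC F q0 l); ring.
Qed.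

(** This is where G <> F is used: if l = 1 a.e. then dG = dF. *)
Lemma norm_gap_neq0 : inner F u u != 0.
Proof.
apply/eqP => /(inner_eq0 L2_gap) u0; apply: GneqF; apply: sqrt_density_eq1 => //.
apply: filterS u0 => x /(_ I); rewrite /u /q0/= mulr1 addrC => /eqP.
by rewrite subr_eq0 => /eqP.
Qed.

Lemma reflection_coef_l : reflection_coef F u l = 1.
Proof.
have un := norm_gap_neq0.
rewrite /reflection_coef inner_gap ?inner_sqrt_density//; last first.
  exact: L2_sqrt_density.
by rewrite -norm_gap divff.
Qed.

Lemma reflection_coef_q0 : reflection_coef F u q0 = -1.
Proof.
have un := norm_gap_neq0; have L1 := L2_q0 F.
rewrite /reflection_coef inner_gap// inner_q0 (innerC F q0 l).
by apply: (mulIf un); rewrite divfK// norm_gap; ring.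
Qed.

Definition gap_isometry (psi : T -> R) := householder F u (Ml psi).
Local Notation K := gap_isometry.

Lemma L2_mul_l psi : L2 G psi -> L2 F (Ml psi).
Proof. by move=> Lpsi; apply/(L2_sqrt_densityM GF (L2_measurable Lpsi)). Qed.

(** The reflection takes l back to 1. *)
Lemma gap_isometry_q0 : K q0 = q0.
Proof.
have e : Ml q0 = l by apply/funext => x; rewrite /q0/= mulr1.
apply/funext => x; rewrite /K e /householder reflection_coef_l /u; ring.
Qed.

Lemma brownian_motion_gap_isometry (dO : measure_display)
    (Omega : measurableType dO) (P : probability Omega R)
    (w : (T -> R) -> {RV P >-> R}) :
  brownian_motion F w -> brownian_motion G (fun psi => w (K psi)).
Proof.
have Lu := L2_gap; have un := norm_gap_neq0.
apply: brownian_motion_isometry => [psi Lpsi|a phi psi Lphi Lpsi|phi psi Lphi Lpsi].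
- by apply: L2_householder => //; exact: L2_mul_l.
- rewrite /K -householder_lin//; [|exact: L2_mul_l..].
  by congr householder; apply/funext => x; ring.
- by rewrite inner_householder//; [exact: inner_sqrt_densityM|exact: L2_mul_l..].
Qed.

(** The integral of (l^2 - l) psi is <l psi, u>, and 1 - <l, 1> is half of
    <u, u>. *)
Lemma bridge_transformE (dO : measure_display)
    (Omega : measurableType dO) (P : probability Omega R)
    (v : (T -> R) -> {RV P >-> R}) psi :
  bridge_transform F G v psi = v (Ml psi) - reflection_coef F u (Ml psi) *: v l.
Proof.
congr (_ - _ *: _).
have -> : \int[F]_x ((l x ^+ 2 - l x) * psi x) = inner F (Ml psi) u.
  by apply: eq_Rintegral => x _; rewrite /u /q0/=; ring.
have -> : \int[F]_x l x = inner F l q0.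
  by apply: eq_Rintegral => x _; rewrite /q0/= mulr1.
have := norm_gap_neq0; rewrite /reflection_coef norm_gap => un.
have /negP : 1 - inner F l q0 != 0 by apply: contraNN un => /eqP->; rewrite mulr0.
by move=> un'; field; apply/negP.
Qed.

(** Both sides are combinations of w(l psi), w(l) and w(1); the coefficients of
    w(1) agree because c (1 - <l, 1>) = <l psi, u>. *)
Lemma bridge_of_gap_isometry (dO : measure_display)
    (Omega : measurableType dO) (P : probability Omega R)
    (w : (T -> R) -> {RV P >-> R}) psi :
  as_linear F w -> L2 G psi ->
  bridge_of G (fun psi => w (K psi)) psi =
  bridge_transform F G (bridge_of F w) psi %[ae P].
Proof.
move=> [_ wlin] Lpsi; have Lu := L2_gap; have Ll := L2_sqrt_density GF.
have Llpsi := L2_mul_l Lpsi; have L1 := L2_q0 F.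
rewrite bridge_transformE /bridge_of gap_isometry_q0.
set c := reflection_coef F u (Ml psi).
have hc : c * (1 - inner F l q0) = inner F (Ml psi) l - inner F (Ml psi) q0.
  have un := norm_gap_neq0.
  rewrite -inner_gap//; apply: (mulIf un); rewrite mulrAC divfK// norm_gap; ring.
have hG : inner G psi q0 = inner F (Ml psi) l.
  rewrite -(inner_sqrt_densityM GF Lpsi (L2_q0 G)).
  by apply: eq_Rintegral => x _; rewrite /q0/= mulr1.
have wK := wlin (- c) _ _ Lu Llpsi.
have wu := wlin (-1) _ _ L1 Ll.
apply: filterS2 wK wu => t /(_ I) wK /(_ I) wu _.
have {}wK : w (K psi) t = - c * w u t + w (Ml psi) t := wK.
have {}wu : w u t = -1 * w q0 t + w l t := wu.
change (w (K psi) t - inner G psi q0 * w q0 t =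
  w (Ml psi) t - inner F (Ml psi) q0 * w q0 t - c * (w l t - inner F l q0 * w q0 t)).
have {}hG : inner G psi q0 = c * (1 - inner F l q0) + inner F (Ml psi) q0.
  by rewrite hG hc /=; ring.
rewrite wK wu hG /=; ring.
Qed.

End reflection.

(** * Finite-dimensional distributions *)

Section finite_dimensional_distributions.
Context (R : realType) (I J : Type) (D : set I) (E : set J).

(** The n new coordinates are a measurable function of the n + 1 coordinates
    indexed by b and the h j. *)
Lemma same_fdd_lin (d1 : measure_display) (O1 : measurableType d1)
    (P1 : probability O1 R) (X : I -> {RV P1 >-> R})
    (d2 : measure_display) (O2 : measurableType d2) (P2 : probability O2 R)
    (Y : I -> {RV P2 >-> R}) (b : I) (h : J -> I) (c : J -> R) :
  D b -> (forall j, E j -> D (h j)) -> same_fdd D X Y ->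
  same_fdd E (fun j => X (h j) - c j *: X b : {RV P1 >-> R})
             (fun j => Y (h j) - c j *: Y b : {RV P2 >-> R}).
Proof.
move=> Db Dh XY n j Ej A mA.
(* Coordinate 0 carries the common index b, the others carry the h j. *)
pose i (k : 'I_n.+1) := if unlift ord0 k is Some k' then h (j k') else b.
pose S (t : n.+1.-tuple R) : n.-tuple R :=
  [tuple tnth t (lift ord0 k) - c (j k) * tnth t ord0 | k < n].
have mS : measurable_fun setT S.
  apply/measurable_fun_tnthP => k.
  have -> : (@tnth n R ^~ k) \o S =
      (fun t => tnth t (lift ord0 k) - c (j k) * tnth t ord0).
    by apply/funext => t; rewrite /= tnth_mktuple.
  apply: measurable_funB; first exact: measurable_tnth.
  by apply: measurable_funM => //; exact: measurable_tnth.
have mSA : measurable (S @^-1` A) by rewrite -[_ @^-1` _]setTI; exact: mS.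
have Di k : D (i k) by rewrite /i; case: unliftP => // k' _; exact: Dh.
have SE (d : measure_display) (O : measurableType d) (P : probability O R)
    (Z : I -> {RV P >-> R}) :
    [set t | A [tuple (Z (h (j k)) - c (j k) *: Z b) t | k < n]] =
    [set t | (S @^-1` A) [tuple Z (i k) t | k < n.+1]].
  apply/funext => t /=; congr A; apply: eq_from_tnth => k.
  by rewrite !tnth_mktuple /i liftK unlift_none.
by rewrite !SE; exact: XY.
Qed.

Lemma same_fdd_ae (d1 : measure_display) (O1 : measurableType d1)
    (P1 : probability O1 R) (X Y : J -> {RV P1 >-> R}) :
  (forall j, E j -> X j = Y j %[ae P1]) -> same_fdd E X Y.
Proof.
move=> XY n j Ej A mA.
have mZ (Z : J -> {RV P1 >-> R}) :
    measurable [set t | A [tuple Z (j k) t | k < n]].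
  have : measurable_fun setT (fun t => [tuple Z (j k) t | k < n]).
    apply/measurable_fun_tnthP => k.
    by apply: eq_measurable_fun (measurable_funP (Z (j k))) => t _ /=; rewrite tnth_mktuple.
  by move=> /(_ measurableT _ mA); rewrite setTI.
rewrite -[LHS]mul1e -[RHS]mul1e -!integral_cst//.
rewrite [LHS]integral_mkcond [RHS]integral_mkcond.
apply: ae_eq_integral => //; try by apply/(measurable_restrictT _ _).1.
have : \forall t \ae P1, forall k, X (j k) t = Y (j k) t.
  by apply: filter_forall => k; apply: filterS (XY _ (Ej k)) => t; exact.
apply: filterS => t XYt _; rewrite !patchE.
have e : [tuple X (j k) t | k < n] = [tuple Y (j k) t | k < n] by exact: eq_mktuple.
by congr (if _ then _ else _); apply/idP/idP; rewrite !inE/= e.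
Qed.

Lemma same_fdd_trans (d1 d2 d3 : measure_display) (O1 : measurableType d1)
    (O2 : measurableType d2) (O3 : measurableType d3)
    (P1 : probability O1 R) (P2 : probability O2 R) (P3 : probability O3 R)
    (X : J -> {RV P1 >-> R}) (Y : J -> {RV P2 >-> R}) (Z : J -> {RV P3 >-> R}) :
  same_fdd E X Y -> same_fdd E Y Z -> same_fdd E X Z.
Proof. by move=> XY YZ n j Ej A mA; rewrite XY// YZ. Qed.

End finite_dimensional_distributions.

(** * The transformation of bridges *)

Section bridge_transform.
Context (R : realType) (dT : measure_display) (T : measurableType dT).
Variables F G : probability T R.
Hypotheses (GF : G `<< F)
  (GneqF : ~ (forall A : set T, measurable A -> G A = F A)).
Context (disp : measure_display) (Omega : measurableType disp)
  (P : probability Omega R).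
Implicit Types v : (T -> R) -> {RV P >-> R}.
Local Notation l := (sqrt_density F G).

(** Omega need not carry the Gaussian variable w(1) independent of the bridge that
    a Brownian motion for G requires, so w o K is built on the space of w. *)
Lemma brownian_bridge_transform v :
  brownian_bridge F v -> brownian_bridge G (bridge_transform F G v).
Proof.
case=> dW [W] [Q] [w] [wF vw].
exists dW, W, Q, (fun psi => w (gap_isometry F G psi)).
split; first exact: brownian_motion_gap_isometry.
pose h (psi : T -> R) x := l x * psi x.
pose c psi := reflection_coef F (sqrt_density_gap F G) (h psi).
apply: (same_fdd_trans (Y := bridge_transform F G (bridge_of F w))).
  have -> : bridge_transform F G v = fun psi => v (h psi) - c psi *: v l.
    by apply/funext => psi; exact: bridge_transformE.
  have -> : bridge_transform F G (bridge_of F w) =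
      fun psi => bridge_of F w (h psi) - c psi *: bridge_of F w l.
    by apply/funext => psi; exact: bridge_transformE.
  exact: same_fdd_lin (L2_sqrt_density GF) (L2_mul_l GF) vw.
apply: same_fdd_ae => psi Lpsi; apply: ae_eq_sym.
by apply: bridge_of_gap_isometry => //; case: wF.
Qed.

(** The transform at phi / l reads off v phi up to a multiple of v l, and the
    case phi = 1 determines v l. *)
Lemma bridge_transform_inj v v' : F `<< G ->
  as_linear F v -> v q0 = cst 0 %[ae P] ->
  as_linear F v' -> v' q0 = cst 0 %[ae P] ->
  as_eq G (bridge_transform F G v) (bridge_transform F G v') ->
  as_eq F v v'.
Proof.
move=> FG [vae _] v1 [v'ae _] v'1 vv'.
pose c := reflection_coef F (sqrt_density_gap F G).
have key phi : L2 F phi -> \forall t \ae P,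
    v phi t - c phi * v l t = v' phi t - c phi * v' l t.
  move=> Lphi; pose psi x := phi x / l x.
  have lpsi : (fun x => l x * psi x) = phi %[ae F].
    apply: filterS (sqrt_density_neq0 GF FG) => x lx _.
    by rewrite /psi mulrC divfK.
  have mpsi : measurable_fun setT psi.
    apply: measurable_funM; first exact: L2_measurable Lphi.
    (* The inverse of l is the power -1 also where l vanishes: both are 0. *)
    under eq_fun do rewrite -powR_inv1 ?sqrtr_ge0//.
    exact: measurableT_comp (measurable_powR _) (measurable_sqrt_density GF).
  have Llpsi : L2 F (fun x => l x * psi x).
    have mlpsi : measurable_fun setT (fun x => l x * psi x).
      by apply: measurable_funM => //; exact: measurable_sqrt_density.
    have /L2P[_ iphi] := Lphi; apply/L2P; split=> //.
    apply: le_integrable iphi => //.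
      by apply/measurable_EFinP; exact: measurable_funX.
    move=> x _; rewrite lee_fin !normrX /psi.
    have [->|lx] := eqVneq (l x) 0; last by rewrite mulrC divfK.
    by rewrite mul0r normr0 expr0n exprn_ge0.
  have Lpsi : L2 G psi by apply/(L2_sqrt_densityM GF mpsi).
  have := vv' _ Lpsi; rewrite !bridge_transformE//.
  have -> : reflection_coef F (sqrt_density_gap F G) (fun x => l x * psi x) =
      c phi.
    by rewrite /c /reflection_coef (inner_ae_eql Llpsi Lphi (L2_gap GF) lpsi).
  have e := vae _ _ Llpsi Lphi lpsi; have e' := v'ae _ _ Llpsi Lphi lpsi.
  apply: filterS3 e e' => t /(_ I) e /(_ I) e' /(_ I) h.
  by rewrite -e -e'; exact: h.
have vl : v l = v' l %[ae P].
  have := key _ (L2_q0 F); rewrite /c reflection_coef_q0//.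
  apply: filterS3 v1 v'1 => t /(_ I)/= v1 /(_ I)/= v'1 h _.
  by move: h; rewrite v1 v'1; lra.
move=> phi Lphi; apply: filterS2 vl (key _ Lphi) => t /(_ I) -> h _.
exact: addIr h.
Qed.

End bridge_transform.

(* R^d is d.-tuple R with the sigma-algebra generated by the coordinates.
   G <> F is read on measurable sets, the only ones where a measure of the
   library is meaningful. *)
Theorem theorem2 (R : realType) (d : nat) (F G : probability (d.-tuple R) R)
    (disp : measure_display) (Omega : measurableType disp)
    (P : probability Omega R) :
  G `<< F ->
  ~ (forall A : set (d.-tuple R), measurable A -> G A = F A) ->
  (forall vF : (d.-tuple R -> R) -> {RV P >-> R},
     brownian_bridge F vF -> brownian_bridge G (bridge_transform F G vF)) /\
  (F `<< G ->
   forall v v' : (d.-tuple R -> R) -> {RV P >-> R},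
     as_linear F v -> v q0 = cst 0 %[ae P] ->
     as_linear F v' -> v' q0 = cst 0 %[ae P] ->
     as_eq G (bridge_transform F G v) (bridge_transform F G v') ->
     as_eq F v v').
Proof.
move=> GF GneqF; split; first by move=> vF; exact: brownian_bridge_transform.
by move=> FG v v'; exact: bridge_transform_inj.
Qed.
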